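(* Weak quasistability does not imply power boundedness: there exists an operator $T$ on the Hilbert space $\ell_+^2$ that is weakly quasistable but is not power bounded, that is, $\sup_n\|T^n\|=\infty$.
   Context: $\ell_+^2$ is the Hilbert space of square-summable one-sided sequences. An operator is a bounded linear transformation of a space into itself. An operator $T$ on a Hilbert space $\mathcal{H}$ with inner product $\langle\cdot\,;\cdot\rangle$ is weakly quasistable if for each $x\in\mathcal{H}$ there exists a strictly increasing sequence $\{n_j\}=\{n_j(x)\}$ of positive integers (which may depend on $x$ but not on $y$) such that $\lim_j|\langle T^{n_j}x\,;y\rangle|=0$ for every $y\in\mathcal{H}$. $T$ is power bounded if $\sup_n\|T^n\|<\infty$. *)

(* Defs.v *)
From HB Require Import structures.
From mathcomp Require Import all_boot all_order all_algebra.
From mathcomp Require Import complex.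
From mathcomp Require Import ring lra.
From mathcomp Require Import all_classical all_reals all_analysis.

Set Implicit Arguments.
Unset Strict Implicit.
Unset Printing Implicit Defensive.

Import Order.TTheory GRing.Theory Num.Def Num.Theory.
Import numFieldNormedType.Exports.

Local Open Scope classical_set_scope.
Local Open Scope ring_scope.

(* The scalars are the complex numbers R[i] over R : realType; the regular
   module R[i]^o carries the topology of R[i] as a numFieldType. *)

Section complex_limits.
Context {R : realType}.

Lemma cvg_complex (u : nat -> R[i]^o) (l : R[i]) :
  complex.Re (u n) @[n --> \oo] --> complex.Re l ->
  complex.Im (u n) @[n --> \oo] --> complex.Im l ->
  u n @[n --> \oo] --> (l : R[i]^o).
Proof.
move=> uRe uIm; apply/cvgrPdist_lt => -[e e'] /=.
rewrite ltcE /= => /andP[/eqP -> e0].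
have e2 : 0 < e / 2 by rewrite divr_gt0.
move/cvgrPdist_lt : uRe => /(_ _ e2) nRe.
move/cvgrPdist_lt : uIm => /(_ _ e2) nIm.
apply: filterS2 nRe nIm => n nRe nIm.
rewrite [X in `|X|](_ : _ = (complex.Re l - complex.Re (u n))%:C%C
  + 'i%C * (complex.Im l - complex.Im (u n))%:C%C); last first.
  by case: l {nRe nIm} => a b; case: (u n) => c d; simpc.
rewrite (le_lt_trans (ler_normD _ _))// normrM.
have -> : `|'i%C : R[i]| = 1 by rewrite normc_def /= expr0n expr1n add0r sqrtr1.
rewrite mul1r !normc_def /= !expr0n !addr0 !sqrtr_sqr.
rewrite -[X in X < _]rmorphD ltcR (splitr e) ltrD//.
Qed.

Lemma normc_ge_ReIm (z : R[i]) : `|complex.Re z| <= Normc.normc z /\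
  `|complex.Im z| <= Normc.normc z.
Proof.
by case: z => a b /=; rewrite -!sqrtr_sqr !ler_wsqrtr ?lerDl ?lerDr ?sqr_ge0.
Qed.

Lemma cvg_limC (u : nat -> R[i]^o) (l : R[i]) :
  u n @[n --> \oo] --> (l : R[i]^o) -> limn u = l.
Proof.
apply (@cvg_lim (R[i]^o : topologicalType)); first exact: norm_hausdorff.
exact: eventually_filter.
Qed.

Lemma cvg_Re (u : nat -> R[i]^o) (l : R[i]) :
  u n @[n --> \oo] --> (l : R[i]^o) ->
  complex.Re (u n) @[n --> \oo] --> complex.Re l.
Proof.
move=> ul; apply/cvgrPdist_lt => e e0.
have e0' : 0 < e%:C%C :> R[i] by rewrite ltcR.
move/cvgrPdist_lt : ul => /(_ _ e0'); apply: filterS => n.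
rewrite normc_def ltcR; apply: le_lt_trans.
have [+ _] := normc_ge_ReIm (l - u n).
by case: l => a b; case: (u n) => c d.
Qed.

Lemma Re_sum n (u : nat -> R[i]) :
  complex.Re (\sum_(0 <= k < n) u k) = \sum_(0 <= k < n) complex.Re (u k).
Proof.
elim: n => [|n IH]; first by rewrite !big_nil.
by rewrite !big_nat_recr//= -IH; case: (\sum_(_ <= _ < _) _) (u n) => ? ? [].
Qed.

Lemma Im_sum n (u : nat -> R[i]) :
  complex.Im (\sum_(0 <= k < n) u k) = \sum_(0 <= k < n) complex.Im (u k).
Proof.
elim: n => [|n IH]; first by rewrite !big_nil.
by rewrite !big_nat_recr//= -IH; case: (\sum_(_ <= _ < _) _) (u n) => ? ? [].
Qed.

Lemma cvg_series_norm (u : nat -> R[i]^o) (v : nat -> R) :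
  (forall k, Normc.normc (u k) <= v k) -> cvgn (series v) ->
  cvgn (series u).
Proof.
move=> uv cv.
have cf (f : nat -> R) : (forall k, `|f k| <= v k) -> cvgn (series f).
  move=> fv; apply: normed_cvg; apply: series_le_cvg cv => // n.
  - exact: normr_ge0.
  - by apply: le_trans (fv n).
have cRe := cf (fun k => complex.Re (u k))
  (fun k => le_trans (normc_ge_ReIm (u k)).1 (uv k)).
have cIm := cf (fun k => complex.Im (u k))
  (fun k => le_trans (normc_ge_ReIm (u k)).2 (uv k)).
move: cRe cIm => /cvg_ex[a ca] /cvg_ex[b cb].
apply/cvg_ex; exists (a +i* b)%C; apply: cvg_complex => /=.
- apply: cvg_trans ca; apply: near_eq_cvg; near=> n.
  by rewrite /series/= Re_sum.
- apply: cvg_trans cb; apply: near_eq_cvg; near=> n.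
  by rewrite /series/= Im_sum.
Unshelve. all: by end_near. Qed.

End complex_limits.

Section square_summable.
Context {R : realType}.
Implicit Types x y : nat -> R[i]^o.

Definition square_summable x :=
  cvgn (series (fun k => `|x k| ^+ 2 : R[i]^o)).

Definition l2_pred : {pred nat -> R[i]^o} :=
  mem [set x | square_summable x].

Lemma square_summableP x : square_summable x <->
  cvgn (series (fun k => Normc.normc (x k) ^+ 2)).
Proof.
split => [/cvg_ex[l]|].
  move=> /cvg_Re xl; apply/cvg_ex; exists (complex.Re l).
  apply: cvg_trans xl; apply: near_eq_cvg; near=> n.
  rewrite /series/= Re_sum; apply: eq_bigr => k _.
  by rewrite normc_def -rmorphXn /=; case: (x k).
apply: cvg_series_norm => k.
rewrite normc_def -rmorphXn /= expr0n addr0 sqrtr_sqr ger0_norm ?sqr_ge0//.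
by case: (x k).
Unshelve. all: by end_near. Qed.

Lemma normcC (z : R[i]) : `|z| = (Normc.normc z)%:C%C.
Proof. by rewrite normc_def; case: z. Qed.

Lemma normc_ge0 (z : R[i]) : 0 <= Normc.normc z.
Proof. by case: z => a b; rewrite sqrtr_ge0. Qed.

Lemma l2_submod_closed : submod_closed l2_pred.
Proof.
split.
  apply/mem_set/square_summableP.
  rewrite [X in series X](_ : _ = (fun=> 0)); last first.
    by apply/funext => k; rewrite (_ : (0 : nat -> R[i]^o) k = 0)// Normc.normc0 expr0n.
  rewrite [series _](_ : _ = cst 0); first exact: is_cvg_cst.
  by apply/funext => n; rewrite /series/= big1.
move=> a x y /set_mem/square_summableP cx /set_mem/square_summableP cy.
apply/mem_set/square_summableP.
have := is_cvg_seriesD (@is_cvg_seriesZ _ _ (2 * Normc.normc a ^+ 2) cx)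
  (@is_cvg_seriesZ _ _ 2 cy).
apply: series_le_cvg => k.
- exact: sqr_ge0.
- by rewrite addr_ge0//= mulr_ge0 ?sqr_ge0// mulr_ge0 ?sqr_ge0.
rewrite [X in Normc.normc X](_ : _ = a * x k + y k)//.
apply: (@le_trans _ _ ((Normc.normc (a * x k) + Normc.normc (y k)) ^+ 2)).
  by rewrite lerXn2r ?nnegrE ?addr_ge0 ?normc_ge0// le_normcD.
rewrite Normc.normcM.
set p := Normc.normc a; set q := Normc.normc (x k); set r := Normc.normc (y k).
rewrite [leRHS](_ : _ = 2 * p ^+ 2 * q ^+ 2 + 2 * r ^+ 2)//.
rewrite -subr_ge0 [X in 0 <= X](_ : _ = (p * q - r) ^+ 2) ?sqr_ge0//.
by ring.
Qed.

HB.instance Definition _ := GRing.isSubmodClosed.Build _ _ l2_pred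
  l2_submod_closed.

(* The complex Hilbert space of square-summable sequences x_0, x_1, ... *)
Record l2 := L2 { l2_val :> nat -> R[i]^o ; _ : l2_val \in l2_pred }.

HB.instance Definition _ := [isSub for l2_val].
HB.instance Definition _ := [Choice of l2 by <:].
HB.instance Definition _ := [SubChoice_isSubLmodule of l2 by <:].

End square_summable.
Arguments l2 : clear implicits.

Section l2_dot.
Context {R : realType}.
Implicit Types x y : l2 R.

Lemma l2P x : cvgn (series (fun k => Normc.normc (x k) ^+ 2)).
Proof. by apply/square_summableP/set_mem; case: x. Qed.

(* Linear in the first argument, conjugate-linear in the second. *)
Definition l2_dot x y : R[i] :=
  limn (series (fun k => x k * (y k)^* : R[i]^o)).

Lemma l2_dot_cvg x y : cvgn (series (fun k => x k * (y k)^* : R[i]^o)).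
Proof.
have cv := is_cvg_seriesD (@l2P x) (@l2P y).
apply: (@cvg_series_norm _ (fun k => x k * (y k)^*)) cv => k.
rewrite Normc.normcM [Normc.normc (y k)^*](_ : _ = Normc.normc (y k)); last first.
  by case: (y k) => a b /=; rewrite sqrrN.
set a := Normc.normc (x k); set b := Normc.normc (y k).
have a0 : 0 <= a by exact: normc_ge0.
have b0 : 0 <= b by exact: normc_ge0.
change (a * b <= a ^+ 2 + b ^+ 2).
by have := sqr_ge0 (a - b); have := mulr_ge0 a0 b0; nra.
Qed.

Lemma l2_dot_hermitian x y : l2_dot x y = (-1) ^+ false * (l2_dot y x)^*.
Proof.
rewrite expr0 mul1r [LHS]/l2_dot; apply cvg_limC.
apply/cvgrPdist_lt => e e0; have := @l2_dot_cvg y x.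
move=> /cvgrPdist_lt /(_ e e0); apply: filterS => n.
rewrite -norm_conjC rmorphB /= -/(l2_dot y x) /series/= rmorph_sum /=.
rewrite (_ : \sum_(0 <= k < n) (y k * (x k)^*)^* = \sum_(0 <= k < n) x k * (y k)^*) //.
by apply: eq_bigr => k _; rewrite rmorphM/= conjCK mulrC.
Qed.

Lemma l2_dot_linearl y : linear_for *%R (l2_dot^~ y).
Proof.
move=> a x z; rewrite [LHS]/l2_dot; apply cvg_limC.
have cx := @l2_dot_cvg x y; have cz := @l2_dot_cvg z y.
pose S w := series (fun k => w k * (y k)^* : R[i]^o).
have SE : S (a *: x + z) = (fun n => a * S x n + S z n).
  apply/funext => n; rewrite /S /series/= mulr_sumr -big_split/=.
  by apply: eq_bigr => k _; rewrite mulrDl mulrA.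
rewrite -[series _]/(S (a *: x + z)) SE.
exact (cvgD (@cvgMl_tmp _ _ _ _ _ a _ cx) cz).
Qed.

Lemma l2_dot_linearr x : linear_for (conjC \; *%R) (l2_dot x).
Proof.
move=> a y z; rewrite l2_dot_hermitian l2_dot_linearl.
rewrite [l2_dot x y]l2_dot_hermitian [l2_dot x z]l2_dot_hermitian.
by rewrite !expr0 !mul1r rmorphD rmorphM.
Qed.

Lemma l2_dotxx x :
  l2_dot x x = (limn (series (fun k => Normc.normc (x k) ^+ 2)))%:C%C.
Proof.
rewrite [LHS]/l2_dot; apply cvg_limC.
have nE k : x k * (x k)^* = (Normc.normc (x k) ^+ 2)%:C%C.
  by rewrite -normCK normcC -rmorphXn.
apply: cvg_complex => /=.
- have := @l2P x; apply: cvg_trans; apply: near_eq_cvg; near=> n.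
  by rewrite /series/= Re_sum; apply: eq_bigr => k _; rewrite nE.
- rewrite [X in X @ _](_ : _ = cst 0); first exact: cvg_cst.
  apply/funext => n.
  by rewrite /series/= Im_sum big1// => k _; rewrite nE.
Unshelve. all: by end_near. Qed.

Lemma l2_dot_gt0 x : x != 0 -> 0 < l2_dot x x.
Proof.
move=> x0; have [k xk0] : exists k, x k != 0.
  apply: contrapT => /forallNP x0'; move/eqP: x0; apply; apply: val_inj => /=.
  by apply/funext => k; apply/eqP; apply: contrapT => /negP; exact: x0'.
rewrite l2_dotxx ltcR.
apply: (@lt_le_trans _ _ (series (fun k => Normc.normc (x k) ^+ 2) k.+1)).
  rewrite /series/= big_nat_recr//= ltr_wpDl ?sumr_ge0//.
    by move=> i _; exact: sqr_ge0.
  rewrite exprn_gt0// lt_def normc_ge0 andbT.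
  by apply: contra_neq xk0 => /Normc.eq0_normc.
apply: nondecreasing_cvgn_le (@l2P x) _.
by apply/nondecreasing_series => i _ _; exact: sqr_ge0.
Qed.

HB.instance Definition _ := bilinear_isBilinear.Build R[i] (l2 R) (l2 R) R[i]
  *%R (conjC \; *%R) l2_dot (l2_dot_linearl, l2_dot_linearr).
HB.instance Definition _ := isHermitianSesquilinear.Build R[i] (l2 R) false
  conjC l2_dot l2_dot_hermitian.
HB.instance Definition _ := isDotProduct.Build R[i] (l2 R) l2_dot l2_dot_gt0.

End l2_dot.

Section dot_norm.
Context {C : numClosedFieldType} {U : lmodType C} (form : {dot U for conjC}).

Lemma dot_CauchySchwarz (u v : U) :
  `|form u v| <= sqrtC (form u u) * sqrtC (form v v).
Proof.
have [->|v0] := eqVneq v 0.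
  by rewrite linear0r normr0 mulr_ge0// sqrt_dnorm_ge0.
have fv0 : 0 < form v v by rewrite dnorm_gt0.
rewrite -(@ler_pXn2r _ 2)// ?nnegrE ?mulr_ge0 ?sqrt_dnorm_ge0//.
rewrite exprMn !sqrtCK -ler_pdivrMr//.
have := dnorm_ge0 form (u - (form u v / form v v) *: v).
rewrite dnormB dnormZ linearZr_LR/= rmorphM/= fmorphV/= normrM normfV.
rewrite (conj_Creal (gtr0_real fv0)) (gtr0_norm fv0).
set a := form u v; set b := form v v.
have bb : b^* = b by exact/conj_Creal/gtr0_real.
have aE : a^* / b * a = `|a| ^+ 2 / b by rewrite normCK mulrAC [a^* * a]mulrC.
have -> : (`|a| / b) ^+ 2 * b = `|a| ^+ 2 / b.
  by rewrite expr_div_n [b ^+ 2]expr2 invfM mulrA divfK ?gt_eqF.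
rewrite aE rmorphM rmorphXn fmorphV/= bb conj_normC.
by rewrite opprD addrA addrK subr_ge0.
Qed.

Lemma dot_normD (u v : U) :
  sqrtC (form (u + v) (u + v)) <= sqrtC (form u u) + sqrtC (form v v).
Proof.
rewrite -(@ler_pXn2r _ 2)// ?nnegrE ?addr_ge0 ?sqrt_dnorm_ge0//.
rewrite sqrtCK sqrrD !sqrtCK dnormD/= addrAC lerD2r lerD2l.
have -> : form u v + (form u v)^* = 'Re (form u v) *+ 2.
  by rewrite ReE -mulr_natr divfK ?pnatr_eq0.
rewrite lerMn2r/= (le_trans _ (dot_CauchySchwarz u v))//.
by rewrite (leif_Re_Creal _).
Qed.

End dot_norm.

Section l2_norm.
Context {R : realType}.

Let norm (x : l2 R) : R[i] := sqrtC (l2_dot x x).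

Let norm_scale (a : R[i]) x : norm (a *: x) = `|a| * norm x.
Proof. by rewrite /norm dnormZ rootCMl ?exprn_ge0// sqrCK. Qed.

Let norm_eq0 x : norm x = 0 -> x = 0.
Proof. by move/eqP; rewrite sqrt_dnorm_eq0 => /eqP. Qed.

HB.instance Definition _ := Lmodule_isNormed.Build R[i] (l2 R)
  (dot_normD (@l2_dot R)) norm_scale norm_eq0.

Lemma l2_normE (x : l2 R) : `|x| = sqrtC (l2_dot x x).
Proof. by []. Qed.

End l2_norm.

Section operators.
Context {R : realType}.

Definition bounded_operator {U V : normedModType R[i]} (T : U -> V) :=
  exists M : R, forall x, `|T x| <= M%:C%C * `|x|.

(* The norm of a normedModType over R[i] is R[i]-valued (with nonnegative real
   values); complex.Re brings it back to R. *)
Definition opnorm {U V : normedModType R[i]} (T : U -> V) : \bar R :=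
  ereal_sup [set (complex.Re `|T x|)%:E | x in [set x | `|x| <= 1]].

Definition power_bounded {U : normedModType R[i]} (T : U -> U) :=
  (ereal_sup (range (fun n => opnorm (iter n T))) < +oo)%E.

Definition weakly_quasistable {U : lmodType R[i]} (form : {dot U for conjC})
    (T : U -> U) :=
  forall x : U, exists n : nat -> nat,
    [/\ forall j, (0 < n j)%N,
        {homo n : i j / (i < j)%N} &
        forall y : U,
          `|form (iter (n j) T x) y| @[j --> \oo] --> (0 : R[i]^o)].

End operators.

(* Main.v *)
Require Import Defs.
From mathcomp Require Import all_boot all_order all_algebra.
From mathcomp Require Import complex.
From mathcomp Require Import all_classical all_reals all_analysis.
From HB Require Import structures.
From mathcomp Require Import zify.
Import Order.TTheory GRing.Theory Num.Theory.
Import numFieldNormedType.Exports.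
Local Open Scope classical_set_scope.
Local Open Scope ring_scope.

(** The witness is a weighted backward shift [(T x)_i = w_i x_{i+1}], with
    [w_i = (i + 2) / (i + 1)] except that [w_i = 0] when [i + 1] is a
    factorial.  Its powers are [(T^n x)_i = W(i, n) x_{i+n}], where
    [W(i, n) = w_i ... w_{i+n-1}] telescopes to [(i + n + 1) / (i + 1)] if no
    factorial lies in the interval [i + 1, ..., i + n], and is [0] otherwise.

    For [n = k!] the product [W(i, n)] vanishes when [i < n], as [n] then lies
    in that interval, and it is at most [(2 i + 1) / (i + 1) <= 2] when
    [n <= i] ([weight_prod_fact_le2]).  So [|| T^{k!} x ||^2] is at most [4]
    times the tail of the series of [|| x ||^2] from the index [k!] on
    ([energy_iter_shift_le]), and [T^{k!}] tends strongly, hence weakly, to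
    [0]: a single sequence of exponents serves all vectors.

    On the other hand, for [k >= 1], between the factorials [k!] and [(k + 1)!]
    the weights accumulate: with [i = k!] and [n = (k + 1)! - k! - 1] one has
    [W(i, n) = (k + 1)! / (k! + 1)], which is unbounded in [k] and is a lower
    bound of [|| T^n ||] ([weight_prod_le_opnorm]). *)

(** * The squared norm of a square-summable sequence *)

Section l2_energy.
Context {R : realType}.
Implicit Types x y : l2 R.

(** The squared norm of [x], as a real number. *)
Definition energy x : R := limn (series (fun k => Normc.normc (x k) ^+ 2)).

Lemma mem_l2_bounded (u : nat -> R[i]^o) (M : R) :
  (forall n, \sum_(0 <= k < n) Normc.normc (u k) ^+ 2 <= M) -> u \in l2_pred.
Proof.
move=> uM; apply/mem_set/square_summableP/nondecreasing_is_cvgn.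
  by apply/nondecreasing_series => i _ _; exact: sqr_ge0.
by exists M => _ [n _ <-]; exact: uM.
Qed.

Lemma energy_ge_partial x n :
  \sum_(0 <= k < n) Normc.normc (x k) ^+ 2 <= energy x.
Proof.
apply: (@nondecreasing_cvgn_le _ (series (fun k => Normc.normc (x k) ^+ 2))).
- by apply/nondecreasing_series => i _ _; exact: sqr_ge0.
- exact: l2P.
Qed.

Lemma energy_le x (M : R) :
  (forall n, \sum_(0 <= k < n) Normc.normc (x k) ^+ 2 <= M) -> energy x <= M.
Proof.
by move=> h; apply: limr_le; [exact: l2P | near=> n; exact: h].
Unshelve. all: by end_near. Qed.

Lemma energy_ge0 x : 0 <= energy x.
Proof. by have := energy_ge_partial x 0; rewrite big_nil. Qed.

Lemma l2_norm_energy x : `|x| = (Num.sqrt (energy x))%:C%C.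
Proof.
rewrite l2_normE l2_dotxx -/(energy x) -{1}(sqr_sqrtr (energy_ge0 x)).
by rewrite rmorphXn /= sqrCK// lecR sqrtr_ge0.
Qed.

Lemma normc_scale (a : R) (z : R[i]) : 0 <= a ->
  Normc.normc (a%:C%C * z) = a * Normc.normc z.
Proof.
by move=> a0; rewrite Normc.normcM /= expr0n addr0 sqrtr_sqr ger0_norm.
Qed.

Lemma normc_le_norm x i : Normc.normc (x i) <= complex.Re `|x|.
Proof.
rewrite l2_norm_energy /= -(ger0_norm (normc_ge0 (x i))) -sqrtr_sqr ler_wsqrtr//.
apply: le_trans (energy_ge_partial x i.+1).
by rewrite big_nat_recr//= lerDr sumr_ge0// => k _; exact: sqr_ge0.
Qed.

(** Strong convergence to [0] implies weak convergence to [0]. *)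
Lemma cvg_energy0_weak (u : nat -> l2 R) y :
  energy (u j) @[j --> \oo] --> 0 ->
  `|l2_dot (u j) y| @[j --> \oo] --> (0 : R[i]^o).
Proof.
move=> u0; apply: cvg_complex; last first.
  rewrite (_ : (fun _ => _) = cst 0); first exact: cvg_cst.
  by apply/funext => j; rewrite normcC.
apply: (@squeeze_cvgr _ _ _ _ (cst 0)
  (fun j => Num.sqrt (energy (u j)) * Num.sqrt (energy y))).
- near=> j; rewrite normcC /= normc_ge0 /=.
  have := @dot_CauchySchwarz _ _ (@l2_dot R) (u j) y.
  by rewrite -!l2_normE !l2_norm_energy normcC -rmorphM lecR.
- exact: cvg_cst.
- rewrite -[X in _ --> X](mul0r (Num.sqrt (energy y))).
  apply: cvgMr_tmp.
  rewrite -[X in _ --> X]sqrtr0.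
  exact: (cvg_comp _ _ u0 (@sqrt_continuous R 0)).
Unshelve. all: by end_near. Qed.

Lemma cvg_partial_energy x :
  \sum_(0 <= k < n) Normc.normc (x k) ^+ 2 @[n --> \oo] --> energy x.
Proof. exact: l2P. Qed.

(** The sequence with a [1] in position [m] and [0] elsewhere. *)
Definition unit_seq (m : nat) : nat -> R[i]^o := fun i => (i == m)%:R.

Lemma unit_seq_partial m n :
  \sum_(0 <= k < n) Normc.normc (unit_seq m k) ^+ 2 = (m < n)%:R.
Proof.
elim: n => [|n IH]; first by rewrite big_nil.
rewrite big_nat_recr//= IH /unit_seq [in RHS]ltnS [in RHS]leq_eqVlt [n == m]eq_sym.
have [->|_] := eqVneq m n; first by rewrite ltnn Normc.normc1 expr1n add0r.
by rewrite Normc.normc0 expr0n addr0.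
Qed.

Lemma unit_seq_l2 m : unit_seq m \in l2_pred.
Proof.
apply: (@mem_l2_bounded _ 1) => n.
by rewrite unit_seq_partial; case: (m < n)%N.
Qed.

(** The canonical basis vector [e_m] of [l2 R]. *)
Definition unit_vec m : l2 R := L2 (unit_seq_l2 m).

Lemma norm_unit_vec_le1 m : `|unit_vec m| <= 1.
Proof.
rewrite l2_norm_energy -[X in _ <= X]/((1 : R)%:C%C) lecR -sqrtr1.
rewrite ler_wsqrtr//; apply: energy_le => n.
by rewrite unit_seq_partial; case: (m < n)%N.
Qed.

End l2_energy.

(** * The weighted shift with zero weights at the factorials *)

Section gapped_shift.
Context {R : realType}.
Implicit Types x y : l2 R.

(** The weights: the ratios of consecutive terms of [1, 2, 3, ...], set to [0]
    at the predecessors of the factorials. *)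
Definition weight (i : nat) : R :=
  if `[< exists k, k`! = i.+1 >] then 0 else i.+2%:R / i.+1%:R.

(** The coefficient of [x (i + n)] in the entry [i] of the [n]-th iterate of
    the shift at [x]. *)
Definition weight_prod (i n : nat) : R := \prod_(i <= j < i + n) weight j.

Lemma weight_ge0 i : 0 <= weight i.
Proof. by rewrite /weight; case: ifP => // _; rewrite divr_ge0. Qed.

Lemma weight_le i : weight i <= i.+2%:R / i.+1%:R.
Proof. by rewrite /weight; case: ifP => // _; rewrite divr_ge0. Qed.

Lemma weight_le2 i : weight i <= 2.
Proof.
apply: le_trans (weight_le i) _.
by rewrite ler_pdivrMr ?ltr0n// -natrM ler_nat; lia.
Qed.

Lemma weight_prod_ge0 i n : 0 <= weight_prod i n.
Proof. by apply: prodr_ge0 => j _; exact: weight_ge0. Qed.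

Lemma weight_prodS i n : weight_prod i n.+1 = weight i * weight_prod i.+1 n.
Proof.
by rewrite /weight_prod big_ltn ?addSnnS// -[X in (X < _)%N]addn0 ltn_add2l.
Qed.

(** The telescoping step. *)
Lemma weight_ratioM i n : i.+2%:R / i.+1%:R * ((i.+1 + n).+1%:R / i.+2%:R)
  = (i + n.+1).+1%:R / i.+1%:R :> R.
Proof. by rewrite mulrC mulrA divfK ?pnatr_eq0// addSnnS. Qed.

Lemma weight_prod_le i n : weight_prod i n <= (i + n).+1%:R / i.+1%:R.
Proof.
elim: n i => [|n IH] i.
  by rewrite /weight_prod addn0 big_geq// divff.
rewrite weight_prodS -weight_ratioM.
by apply: ler_pM; rewrite ?weight_ge0 ?weight_prod_ge0 ?weight_le ?IH.
Qed.

(** The zero weight of index [k`!.-1] is among the [n] factors from [i] on. *)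
Lemma weight_prod_eq0 i n k : (i < k`! <= i + n)%N -> weight_prod i n = 0.
Proof.
move=> /andP[ik kn]; rewrite /weight_prod.
rewrite (@big_cat_nat _ _ _ k`!.-1) /=; [|lia|lia].
rewrite [X in _ * X]big_ltn; last by lia.
rewrite /weight; case: ifPn => [_|/asboolPn []]; first by rewrite mul0r mulr0.
by exists k; rewrite prednK ?fact_gt0.
Qed.

(** No zero weight occurs strictly between two consecutive factorials. *)
Lemma weight_prod_gap i n k : (k`! <= i)%N -> (i + n < k.+1`!)%N ->
  weight_prod i n = (i + n).+1%:R / i.+1%:R.
Proof.
elim: n i => [|n IH] i ki ik.
  by rewrite /weight_prod addn0 big_geq// divff.
rewrite weight_prodS IH; [|lia|lia].
rewrite -weight_ratioM /weight; case: ifPn => // /asboolP[m mi]; exfalso.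
have [mk|km] := leqP m k.
  by have := @leq_fact _ _ mk; lia.
by have := @leq_fact _ _ km; lia.
Qed.

(** Either [i < k`!] and the product is [0], or [k`!] is at most [i] and the
    telescoped ratio is at most [2]. *)
Lemma weight_prod_fact_le2 i k : weight_prod i k`! <= 2.
Proof.
have [ik|ki] := ltnP i k`!.
  by rewrite (@weight_prod_eq0 _ _ k) ?ik ?leq_addl.
apply: le_trans (weight_prod_le _ _) _.
by rewrite ler_pdivrMr ?ltr0n// -natrM ler_nat; lia.
Qed.

Definition shift_seq x : nat -> R[i]^o := fun i => (weight i)%:C%C * x i.+1.

Lemma shift_seq_l2 x : shift_seq x \in l2_pred.
Proof.
apply: (@mem_l2_bounded _ _ (2 ^+ 2 * energy x)) => n.
apply: (@le_trans _ _ (2 ^+ 2 * \sum_(0 <= k < n) Normc.normc (x k.+1) ^+ 2)).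
  rewrite mulr_sumr; apply: ler_sum => k _.
  rewrite normc_scale ?weight_ge0// exprMn ler_wpM2r ?sqr_ge0//.
  by rewrite lerXn2r ?nnegrE ?weight_ge0 ?weight_le2.
rewrite ler_wpM2l ?sqr_ge0//; apply: le_trans (energy_ge_partial x n.+1).
by rewrite big_nat_recl// lerDr sqr_ge0.
Qed.

(** The backward shift on [l2 R] weighted by [weight]. *)
Definition shift x : l2 R := L2 (shift_seq_l2 x).

Lemma shift_is_linear : linear shift.
Proof.
move=> a x y; apply: val_inj; apply/funext => i /=.
rewrite /shift_seq /=.
change ((weight i)%:C%C * (a * x i.+1 + y i.+1) =
  a * ((weight i)%:C%C * x i.+1) + (weight i)%:C%C * y i.+1).
by rewrite mulrDr mulrCA.
Qed.

HB.instance Definition _ :=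
  GRing.isLinear.Build R[i] (l2 R) (l2 R) _ shift shift_is_linear.

Lemma iter_shiftE n x i :
  iter n shift x i = (weight_prod i n)%:C%C * x (i + n)%N.
Proof.
elim: n i => [|n IH] i /=.
  by rewrite /weight_prod addn0 big_geq// mul1r.
by rewrite /shift_seq IH weight_prodS rmorphM mulrA addSnnS.
Qed.

(** The [n]-th iterate forgets the first [n] entries of [x], so only the tail
    of the series of [energy x] from the index [n] on contributes. *)
Lemma energy_iter_shift_le x n (C : R) : (forall i, weight_prod i n <= C) ->
  energy (iter n shift x) <=
  C ^+ 2 * (energy x - \sum_(0 <= k < n) Normc.normc (x k) ^+ 2).
Proof.
move=> hC; apply: energy_le => N.
apply: (@le_trans _ _
  (C ^+ 2 * \sum_(0 <= i < N) Normc.normc (x (i + n)%N) ^+ 2)).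
  rewrite mulr_sumr; apply: ler_sum => i _.
  rewrite iter_shiftE normc_scale ?weight_prod_ge0// exprMn ler_wpM2r ?sqr_ge0//.
  by rewrite lerXn2r ?nnegrE ?weight_prod_ge0 ?(le_trans (weight_prod_ge0 i n)).
rewrite ler_wpM2l ?sqr_ge0// lerBrDl.
apply: le_trans (energy_ge_partial x (N + n)).
rewrite (@big_cat_nat _ _ _ n 0 (N + n)) ?leq_addl//= lerD2l.
by rewrite -{2}[n]add0n big_addn addnK.
Qed.

Lemma shift_bounded : bounded_operator shift.
Proof.
exists 2 => x; rewrite !l2_norm_energy -rmorphM lecR /=.
have -> : 2 = Num.sqrt (2 ^+ 2) :> R by rewrite sqrtr_sqr ger0_norm.
rewrite -sqrtrM ?sqr_ge0// ler_wsqrtr//.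
apply: le_trans (@energy_iter_shift_le x 1 2 _) _.
  by move=> i; rewrite /weight_prod addn1 big_nat1 weight_le2.
rewrite ler_wpM2l ?sqr_ge0// gerBl.
by rewrite big_nat1 sqr_ge0.
Qed.

(** The iterates of factorial order tend strongly to [0]. *)
Lemma energy_iter_shift_fact x :
  energy (iter j.+1`! shift x) @[j --> \oo] --> 0.
Proof.
apply: (@squeeze_cvgr _ _ _ _ (cst 0) (fun j => 2 ^+ 2 *
  (energy x - \sum_(0 <= k < j.+1`!) Normc.normc (x k) ^+ 2))).
- near=> j; rewrite energy_ge0 energy_iter_shift_le// => i.
  exact: weight_prod_fact_le2.
- exact: cvg_cst.
- have fact_oo : j.+1`! @[j --> \oo] --> \oo.
    apply/cvgnyPge => m; near=> j.
    apply: (@leq_trans j); first by near: j; exact: nbhs_infty_ge.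
    exact: leq_trans (leqnSn _) (fact_geq _).
  have tail0 : 2 ^+ 2 *
      (energy x - \sum_(0 <= k < j.+1`!) Normc.normc (x k) ^+ 2) @[j --> \oo]
      --> 2 ^+ 2 * (energy x - energy x).
    apply: cvgMl_tmp; apply: cvgB; first exact: cvg_cst.
    exact: (cvg_comp _ _ fact_oo (cvg_partial_energy x)).
  by rewrite subrr mulr0 in tail0.
Unshelve. all: by end_near. Qed.

Lemma shift_weakly_quasistable : weakly_quasistable (@l2_dot R) shift.
Proof.
move=> x.
(* The shift of the index makes the sequence strictly increasing, as
   [0`! = 1`!]. *)
exists (fun j => j.+1`!); split => [j|i j ij|y].
- exact: fact_gt0.
- by rewrite ltn_pfact.
- exact/cvg_energy0_weak/energy_iter_shift_fact.
Qed.

Lemma weight_prod_le_opnorm i n : ((weight_prod i n)%:E <= opnorm (iter n shift))%E.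
Proof.
apply: (@le_trans _ _ (complex.Re `|iter n shift (unit_vec (i + n))|)%:E).
  rewrite lee_fin; apply: le_trans (normc_le_norm _ i).
  rewrite iter_shiftE normc_scale ?weight_prod_ge0//= /unit_seq eqxx.
  by rewrite Normc.normc1 mulr1.
apply: ereal_sup_ubound; exists (unit_vec (i + n)) => //.
exact: norm_unit_vec_le1.
Qed.

Lemma shift_not_power_bounded : ~ power_bounded shift.
Proof.
rewrite /power_bounded; set s := ereal_sup _ => s_lt.
have h k : (k%:R%:E <= s)%E.
  (* The zero weight of index [k.+2`! - 1] is just missed.  Starting from
     [k.+1`!], not [k`!], keeps the two factorials distinct, and the entry
     [k.+2`! / (k.+1`!).+1] is then at least [k]. *)
  pose n := (k.+2`! - k.+1`! - 1)%N.
  apply: (@le_trans _ _ (opnorm (iter n shift))); last first.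
    by apply: ereal_sup_ubound; exists n.
  apply: le_trans (weight_prod_le_opnorm k.+1`! n); rewrite lee_fin.
  have k_le := fact_geq k.+1.
  have := factS k.+1; rewrite mulSn => kS.
  rewrite (@weight_prod_gap _ _ k.+1) ?leqnn; [|lia|lia].
  rewrite ler_pdivlMr ?ltr0n// -natrM ler_nat /n; nia.
have s0 : (0 <= s)%E := h 0%N.
have sE : s = (fine s)%:E by rewrite fineK// ge0_fin_numE.
have := archi_boundP (fine_ge0 s0); rewrite ltNge => /negP; apply.
by rewrite -lee_fin -sE.
Qed.

End gapped_shift.

Theorem mainTheorem2 (R : realType) :
  exists T : {linear l2 R -> l2 R},
    [/\ bounded_operator T,
        weakly_quasistable (@l2_dot R) T &
        ~ power_bounded T].
Proof.
exists shift; split.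
- exact: shift_bounded.
- exact: shift_weakly_quasistable.
- exact: shift_not_power_bounded.
Qed.
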